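(* Let $\mathcal{H}$ be an infinite-dimensional separable real Hilbert space with unit sphere $\mathcal{S} = \{x \in \mathcal{H} : \|x\| = 1\}$. For any real $p > 1$, there exists a probability distribution $\nu$ on $\mathcal{S}$ whose set of $L^p$ centres of mass is empty, i.e. there is no $s^* \in \mathcal{S}$ with $F_p(s^* ) = \inf_{s \in \mathcal{S}} F_p(s)$, where $F_p(s) = \int_{\mathcal{S}} d_{\mathcal{S}}(s,x)^p \, \mathrm{d}\nu(x)$ for $s \in \mathcal{S}$.
   Context: The inner product and norm of $\mathcal{H}$ are $\langle \cdot,\cdot\rangle$ and $\|\cdot\| = \langle\cdot,\cdot\rangle^{1/2}$. The sphere $\mathcal{S}$ carries the great-arc distance $d_{\mathcal{S}}(x,x') = \arccos(\langle x,x'\rangle) \in [0,\pi]$. A distribution on $\mathcal{S}$ means a Borel probability measure on $\mathcal{S}$. The $L^p$ centres of mass of $\nu$ are the elements of $\mathcal{S}$ that minimise $F_p$ over $\mathcal{S}$; this set may be empty, a singleton, or have several elements. *)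

(* Defs.v *)
From HB Require Import structures.
From mathcomp Require Import all_boot all_order all_algebra.
From mathcomp Require Import all_classical all_reals all_analysis.

Set Implicit Arguments.
Unset Strict Implicit.
Unset Printing Implicit Defensive.

Import Order.TTheory GRing.Theory Num.Theory.
Import numFieldNormedType.Exports.

Local Open Scope classical_set_scope.
Local Open Scope ring_scope.

Definition separable_space (T : topologicalType) : Prop :=
  exists2 D : set T, countable D & dense D.

Definition finite_dimensional (R : realType) (V : lmodType R) : Prop :=
  exists n (v : 'I_n -> V),
    forall x, exists c : 'I_n -> R, x = \sum_(i < n) c i *: v i.

Section Sphere.
Variables (R : realType) (H : normedModType R).

Definition unit_sphere : set H := [set x | `|x| = 1].

Lemma unit_sphere_nonempty : ~ finite_dimensional H -> exists x, x \in unit_sphere.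
Proof.
move=> infH; apply: contrapT => noS; apply: infH; exists 0%N, (fun=> 0) => x.
exists (fun=> 0); rewrite big_ord0; apply: contrapT => /eqP x0; apply: noS.
exists (`|x|^-1 *: x); rewrite inE /unit_sphere /= normrZ normfV normr_id.
by rewrite mulVf ?normr_eq0.
Qed.

(* The sphere as a type, with the topology induced by H.  It depends on a proof
   that H is infinite-dimensional only because measurable types have to be
   pointed: the sphere of the zero space is empty. *)
Definition sphere_type (infH : ~ finite_dimensional H) : Type := unit_sphere.

Variable infH : ~ finite_dimensional H.

HB.instance Definition _ :=
  Topological.copy (sphere_type infH) (set_type unit_sphere).

Let sphere_point : sphere_type infH :=
  let: exist x Sx := cid (unit_sphere_nonempty infH) in exist _ x Sx.

HB.instance Definition _ := isPointed.Build (sphere_type infH) sphere_point.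

Definition sphere_val (x : sphere_type infH) : H := val x.

Definition borel_sphere := g_sigma_algebraType (@open (sphere_type infH)).

Variable ip : H -> H -> R.

Definition great_arc_dist (x y : sphere_type infH) : R :=
  acos (ip (sphere_val x) (sphere_val y)).

Definition Lp_functional (p : R) (nu : probability borel_sphere R)
    (s : sphere_type infH) : \bar R :=
  (\int[nu]_x ((great_arc_dist s x `^ p)%R)%:E)%E.

Definition Lp_centres (p : R) (nu : probability borel_sphere R) :
    set (sphere_type infH) :=
  [set s | Lp_functional p nu s = ereal_inf (range (Lp_functional p nu))].

End Sphere.

(* Main.v *)
Require Import Defs.
From HB Require Import structures.
From mathcomp Require Import all_boot all_order all_algebra.
From mathcomp Require Import all_classical all_reals all_analysis.
From mathcomp Require Import measurable_realfun ring lra.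

(* Take unit vectors x_k with no common nonzero orthogonal vector, and let nu
   give mass 2^-(k+2) to each of x_k and -x_k.  The distances from s to x_k and
   to -x_k add up to pi, so strict convexity of t |-> t^p bounds the contribution
   of each pair from below, strictly unless s is orthogonal to x_k.  Hence
   F_p(s) > (pi/2)^p for every s.  The bound is nevertheless the infimum: in
   infinite dimension there is a unit vector orthogonal to x_0, ..., x_(n-1), and
   its value of F_p exceeds (pi/2)^p by at most pi^p / 2^n. *)

Set Implicit Arguments.
Unset Strict Implicit.
Unset Printing Implicit Defensive.

Import Order.TTheory GRing.Theory Num.Theory.
Import numFieldNormedType.Exports.

Local Open Scope classical_set_scope.
Local Open Scope ring_scope.

(** * Strict convexity of powers and measurability of the arccosine *)

Section StrictConvexity.
Variable R : realType.
Implicit Types a c p t : R.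

(** For [a > 0] write [a = expR t] and use [1 + u < expR u] twice: [u = (p - 1) * t] bounds the
    power below by [a + (p - 1) * (a * t)], and [u = - t] gives [a - 1 < a * t]. *)
Lemma powR_gt_tangent p a : 1 < p -> 0 <= a -> a != 1 ->
  1 + p * (a - 1) < a `^ p.
Proof.
move=> p1; rewrite le_eqVlt => /predU1P[<- _|a0 a1].
  by rewrite powR0 ?gt_eqF ?(lt_trans ltr01)//; lra.
pose t := ln a; have at_ : a = expR t by rewrite lnK.
have t0 : t != 0 by rewrite ln_eq0.
have p10 : p - 1 != 0 by lra.
have h1 := expR_gt1Dx (mulf_neq0 p10 t0).
have h2 : 1 + - t < expR (- t) by apply: expR_gt1Dx; rewrite oppr_eq0.
have -> : a `^ p = expR t * expR ((p - 1) * t).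
  by rewrite /powR gt_eqF// -expRD -/t; congr expR; ring.
have et := expR_gt0 t.
move: h1 h2; rewrite -(ltr_pM2l et) -(ltr_pM2l et (1 + - t)).
rewrite (expRN t) divff ?gt_eqF// at_ => h1 h2; apply: le_lt_trans h1.
nra.
Qed.

(** After scaling by [c], the two bases [a] and [2 - a] are symmetric about 1, so the linear terms
    of their tangent bounds cancel. *)
Lemma powR_antipodal_gt p c t : 1 < p -> 0 < c -> 0 <= t <= c *+ 2 -> t != c ->
  c `^ p *+ 2 < t `^ p + (c *+ 2 - t) `^ p.
Proof.
move=> p1 c0 /andP[t0 tc] tNc.
have cp : 0 < c `^ p by rewrite powR_gt0.
pose a := t / c; have at_ : t = a * c by rewrite /a divfK ?gt_eqF.
have a0 : 0 <= a by rewrite divr_ge0// ltW.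
have a2 : a <= 2 by rewrite ler_pdivrMr// mulr_natl.
have a1 : a != 1 by apply: contra_neq tNc => h; rewrite at_ h mul1r.
clearbody a; rewrite [X in X `^ _ + _]at_ (_ : c *+ 2 - t = (2 - a) * c); last first.
  by rewrite mulrBl -at_ mulr_natl.
rewrite !powRM ?(ltW c0) ?subr_ge0//.
have h1 := powR_gt_tangent p1 a0 a1.
have h2 : 1 + p * ((2 - a) - 1) < (2 - a) `^ p.
  by apply: powR_gt_tangent => //; lra.
by rewrite -mulrDl -mulr_natl ltr_pM2r//; lra.
Qed.

Lemma powR_antipodal_ge p c t : 1 < p -> 0 < c -> 0 <= t <= c *+ 2 ->
  c `^ p *+ 2 <= t `^ p + (c *+ 2 - t) `^ p.
Proof.
move=> p1 c0 tc; have [->|/(powR_antipodal_gt p1 c0 tc)/ltW//] := eqVneq t c.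
by rewrite mulr2n addrK.
Qed.

Lemma measurable_acos : measurable_fun (`[-1, 1] : set R) (@acos R).
Proof.
have pi0 : (0 : R) <= pi := pi_ge0 R.
have cc : {within `[0, pi], continuous (@cos R)}.
  by apply/continuous_subspaceT => ?; exact: continuous_cos.
have := segment_can_continuous pi0 cc (@cosK R).
(* The inverse of cosine is continuous on the segment between the values of cosine at [pi] and 0. *)
rewrite cos0 cospi min_r ?max_l; [|lra|lra].
by apply: subspace_continuous_measurable_fun; exact: measurable_itv.
Qed.

End StrictConvexity.

(** * Inner product geometry, orthogonal vectors and total sequences *)

Section InnerProduct.
Variables (R : realType) (H : normedModType R) (ip : {dot H for idfun}).
Hypothesis norm_ip : forall x : H, `|x| = Num.sqrt (ip x x).
Implicit Types x y z : H.

Lemma ipC x y : ip x y = ip y x.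
Proof. by rewrite hermC expr0 mul1r. Qed.

Lemma ipDl x y z : ip (x + y) z = ip x z + ip y z.
Proof. by rewrite ipC linearD/= !(ipC z). Qed.

Lemma ipZl a x y : ip (a *: x) y = a * ip x y.
Proof. by rewrite ipC linearZ/= ipC. Qed.

Lemma ip_norm x : ip x x = `|x| ^+ 2.
Proof.
rewrite norm_ip sqr_sqrtr//; have [->|/neq0_dnorm_gt0/ltW//] := eqVneq x 0.
by rewrite linear0.
Qed.

(** The form [ip] is given algebraically; writing it through norms yields its continuity. *)
Lemma polarization x y :
  ip x y = (`|x + y| ^+ 2 - `|x| ^+ 2 - `|y| ^+ 2) / 2.
Proof. by rewrite -!ip_norm ipDl !linearD/= (ipC y x); field. Qed.

Lemma sqr_normD x y : `|x + y| ^+ 2 = `|x| ^+ 2 + `|y| ^+ 2 + ip x y *+ 2.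
Proof. by rewrite polarization; field. Qed.

Lemma sqr_normB x y : `|x - y| ^+ 2 = `|x| ^+ 2 + `|y| ^+ 2 - ip x y *+ 2.
Proof. by rewrite sqr_normD normrN linearN/= mulNrn. Qed.

Lemma ip_continuous x : continuous (fun y => ip x y).
Proof.
move=> y; under eq_fun do rewrite polarization.
apply: cvgMl; apply: cvgB; last first.
  by rewrite expr2; apply: cvgM; apply: norm_continuous.
apply: cvgB; last exact: cvg_cst.
by apply: cvgM; apply: cvg_norm; apply: cvgD => //; exact: cvg_cst.
Qed.

(** The squared norms of [x + y] and [x - y] are [2 + 2 * ip x y] and [2 - 2 * ip x y]. *)
Lemma ip_unit_itv x y : `|x| = 1 -> `|y| = 1 -> -1 <= ip x y <= 1.
Proof.
move=> x1 y1; have := sqr_ge0 `|x + y|; have := sqr_ge0 `|x - y|.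
rewrite sqr_normB sqr_normD x1 y1; lra.
Qed.

(* A residual exists even when the x_i are dependent: Rocq's t / 0 = 0 skips
   the vectors lying in the span of their predecessors. *)
Lemma orthogonal_residual (x : nat -> H) n z : exists c : nat -> R,
  forall j, (j < n)%N -> ip (z - \sum_(i < n) c i *: x i) (x j) = 0.
Proof.
elim: n z => [z|n IH z]; first by exists (fun=> 0).
(* Gram-Schmidt: from the residual [z'] of [z], subtract its projection on the residual [x'] of
   [x n]. *)
have [a ha] := IH (x n); have [b hb] := IH z.
set x' := _ - _ in ha; set z' := _ - _ in hb.
pose t := ip z' x' / ip x' x'.
exists (fun i => if i == n then t else b i - t * a i) => j jn.
have -> : z - \sum_(i < n.+1)
    (if i == n :> nat then t else b i - t * a i) *: x i = z' - t *: x'.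
  rewrite big_ord_recr/= eqxx.
  under eq_bigr => i _ do rewrite ltn_eqF ?ltn_ord// scalerBl -scalerA.
  rewrite sumrB -scaler_sumr /z' /x' scalerBr !opprD !opprK !addrA.
  by rewrite addrAC.
have h k : (k < n)%N -> ip (z' - t *: x') (x k) = 0.
  by move=> kn; rewrite -scaleNr ipDl ipZl ha// hb// mulr0 addr0.
move: jn; rewrite ltnS leq_eqVlt => /predU1P[->|]; last exact: h.
have -> : x n = x' + \sum_(i < n) a i *: x i by rewrite subrK.
rewrite linearD linear_sum/= big1 => [|i _]; last first.
  by rewrite linearZ/= h// mulr0.
rewrite -scaleNr ipDl ipZl addr0 mulNr /t.
have [x0|x0] := eqVneq (ip x' x') 0; last by rewrite divfK// subrr.
suff -> : x' = 0 by rewrite !linear0 mulr0 subrr.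
by apply/eqP; rewrite -normr_eq0 -sqrf_eq0 -ip_norm x0.
Qed.

(** If all residuals vanished, [x 0, ..., x (n - 1)] would span [H]; a nonzero residual can be
    normalised. *)
Lemma exists_unit_orthogonal (x : nat -> H) n : ~ finite_dimensional H ->
  exists2 s : H, `|s| = 1 & forall j, (j < n)%N -> ip s (x j) = 0.
Proof.
move=> infH; apply: contrapT => noS; apply: infH; exists n, (fun i => x i) => z.
have [c hc] := orthogonal_residual x n z.
exists (fun i => c i); apply/eqP; rewrite -subr_eq0; apply: contrapT => /negP.
set r := _ - _ in hc * => r0; apply: noS; exists (`|r|^-1 *: r).
  by rewrite normrZ normfV normr_id mulVf ?normr_eq0.
by move=> j jn; rewrite ipZl hc// mulr0.
Qed.

(** Normalise a countable dense set. A point [y] of it closer to [s] than [|s|] cannot be orthogonal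
    to [s], by Pythagoras. *)
Lemma exists_total_unit_sequence :
  separable_space H -> ~ finite_dimensional H ->
  exists2 x : nat -> H, forall n, `|x n| = 1 &
    forall s, s != 0 -> exists n, ip s (x n) != 0.
Proof.
move=> [D /countable_injP[f finj] denseD] infH.
have [e] := unit_sphere_nonempty infH; rewrite inE /unit_sphere/= => e1.
(* [d] inverts the injection [f] on [D]; at indices outside the image it takes a default value. *)
pose d n := get [set y | D y /\ f y = n].
have dP y : D y -> d (f y) = y.
  move=> Dy; have [Dz fz] : [set z | D z /\ f z = f y] (d (f y)).
    by apply: getPex; exists y.
  by apply: finj; rewrite ?inE.
(* The unit vector [e] stands in for zero vectors. *)
exists (fun n => if d n == 0 then e else `|d n|^-1 *: d n).
  move=> n; case: eqVneq => // dn0.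
  by rewrite normrZ normfV normr_id mulVf ?normr_eq0.
move=> s s0.
have [|y [ys /dP yE]] := denseD (ball s `|s|)^° _ (@open_interior _ _).
  by exists s; apply: nbhsx_ballx; rewrite normr_gt0.
move/interior_subset: ys; rewrite -ball_normE/= => sy.
have ys0 : ip s y != 0.
  apply/eqP => sy0; move: sy; apply/negP; rewrite -leNgt.
  by rewrite -ler_sqr ?nnegrE// sqr_normB sy0 mul0rn subr0 lerDl sqr_ge0.
exists (f y); rewrite yE; case: (eqVneq y 0) => [y0|y0].
  by rewrite y0 linear0 eqxx in ys0.
by rewrite linearZ/= mulf_neq0// invr_eq0 normr_eq0.
Qed.

End InnerProduct.

(** * Borel measurability and the discrete antipodal measure *)

Lemma continuous_borel_measurable (R : realType) (T : ptopologicalType)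
    (f : T -> R) : continuous f ->
  measurable_fun [set: g_sigma_algebraType (@open T)]
    (f : g_sigma_algebraType (@open T) -> R).
Proof.
move=> /continuousP cf; apply: (measurability _ (RGenOpens.measurableE R)).
move=> _ [_ [a [b ->] <-]]; rewrite setTI; apply: sub_sigma_algebra.
exact/cf/interval_open.
Qed.

Section AntipodalMeasure.
Variables (R : realType) (H : normedModType R) (infH : ~ finite_dimensional H).
Implicit Types s : sphere_type infH.

Lemma norm_sphere_val s : `|sphere_val s| = 1.
Proof. exact: (set_mem (valP s)). Qed.

Definition to_sphere (x : H) (x1 : `|x| = 1) : sphere_type infH :=
  exist _ x (mem_set x1).

Lemma norm_opp_sphere_val s : `|- sphere_val s| = 1.
Proof. by rewrite normrN norm_sphere_val. Qed.

Definition antipode s := to_sphere (norm_opp_sphere_val s).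

Lemma sphere_val_continuous : continuous (@sphere_val R H infH).
Proof. exact: initial_continuous. Qed.

(** Each index carries two atoms of this weight, so the shift by 2 makes the total mass 1. *)
Definition dyadic_weight (k : nat) : R := 1 / (2 ^ (k + 2))%:R.

Lemma dyadic_weight_ge0 k : 0 <= dyadic_weight k.
Proof. by rewrite divr_ge0. Qed.

Lemma dyadic_weight_gt0 k : 0 < dyadic_weight k.
Proof. by rewrite divr_gt0// ltr0n expn_gt0. Qed.

(** The case [n = 0] gives the total mass; general [n] controls the tail of the excess series. *)
Lemma dyadic_weight_tail n :
  (\sum_(n <= k <oo) (dyadic_weight k)%:E = (1 / 2 ^+ n.+1)%:E)%E.
Proof.
rewrite -nneseries_addn => [|k]; last by rewrite lee_fin dyadic_weight_ge0.
apply/cvg_lim => //; have := @cvg_geometric_eseries_half R 1 n.+1.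
rewrite (_ : eseries _ = fun m => (\sum_(0 <= k < m) (dyadic_weight (k + n))%:E)%E)//.
by apply/funext => m; apply: eq_bigr => k _; rewrite /dyadic_weight -addnA addn2.
Qed.

Variable x : nat -> sphere_type infH.

Definition antipodal_pair (k : nat) : {measure set (borel_sphere infH) -> \bar R} :=
  mscale (NngNum (dyadic_weight_ge0 k))
    (measure_add (dirac (x k : borel_sphere infH))
                 (dirac (antipode (x k) : borel_sphere infH))).

Definition antipodal_measure : set (borel_sphere infH) -> \bar R :=
  mseries antipodal_pair 0.

HB.instance Definition _ := Measure.on antipodal_measure.

Lemma ge0_integral_antipodal (f : borel_sphere infH -> R) :
  measurable_fun setT f -> (forall s, 0 <= f s) ->
  (\int[antipodal_measure]_s (f s)%:E =
   \sum_(0 <= k <oo) (dyadic_weight k * (f (x k) + f (antipode (x k))))%:E)%E.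
Proof.
move=> mf f0; have mfE : measurable_fun setT (EFin \o f) by exact/measurable_EFinP.
rewrite ge0_integral_measure_series//; last by move=> s _; rewrite lee_fin.
apply: eq_eseriesr => k _.
rewrite ge0_integral_mscale//; last by move=> s _; rewrite lee_fin.
rewrite ge0_integral_measure_add//; last by move=> s _; rewrite lee_fin.
by rewrite !integral_dirac// !diracT !mul1e.
Qed.

Lemma antipodal_measureT : antipodal_measure setT = 1%E.
Proof.
have := @ge0_integral_antipodal (cst 1) (measurable_cst _) (fun=> ler01).
rewrite (integral_cst _ _ 1%E)// mul1e => ->.
under eq_eseriesr do rewrite mulrC EFinM /cst.
rewrite nneseriesZl => [|k _]; last by rewrite lee_fin dyadic_weight_ge0.
by rewrite dyadic_weight_tail -EFinM expr1 mul1r divff.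
Qed.

HB.instance Definition _ :=
  Measure_isProbability.Build _ _ _ antipodal_measure antipodal_measureT.

End AntipodalMeasure.

(** * The functional of the antipodal measure and its unattained infimum *)

Section NoCentre.
Variables (R : realType) (H : normedModType R) (ip : {dot H for idfun}).
Hypothesis norm_ip : forall x : H, `|x| = Num.sqrt (ip x x).
Variables (infH : ~ finite_dimensional H) (p : R).
Hypothesis p_gt1 : 1 < p.
Implicit Types s y : sphere_type infH.

Let p_ge0 : 0 <= p. Proof. exact: le_trans ler01 (ltW p_gt1). Qed.

Lemma ip_sphere_itv s y : -1 <= ip (sphere_val s) (sphere_val y) <= 1.
Proof. by apply: ip_unit_itv => //; exact: norm_sphere_val. Qed.

Lemma great_arc_dist_itv s y : 0 <= great_arc_dist ip s y <= pi.
Proof. by rewrite acos_ge0 ?acos_lepi//; exact: ip_sphere_itv. Qed.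

Lemma great_arc_dist_antipode s y :
  great_arc_dist ip s (antipode y) = pi - great_arc_dist ip s y.
Proof.
rewrite /great_arc_dist -acosN ?ip_sphere_itv//.
by rewrite /sphere_val/= linearN.
Qed.

Lemma measurable_great_arc_dist s :
  measurable_fun [set: borel_sphere infH] (great_arc_dist ip s).
Proof.
pose g (y : sphere_type infH) := ip (sphere_val s) (sphere_val y).
have mg : measurable_fun [set: borel_sphere infH] g.
  apply: continuous_borel_measurable => y.
  apply: continuous_comp; first exact: sphere_val_continuous.
  exact: ip_continuous.
(* [measurable_acos] holds on [[-1, 1]], so the composition needs the range of [g] to lie there. *)
have gI : [set g y | y in [set: borel_sphere infH]] `<=` `[-1, 1].
  by move=> _ [y _ <-]; rewrite /= in_itv/= ip_sphere_itv.
exact: (measurable_comp (measurable_itv _) gI (@measurable_acos R) mg).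
Qed.

(** The contribution of the pair [y], [-y] above its minimum, which is reached when [y] is
    orthogonal to [s]. *)
Definition antipodal_excess s y : R :=
  great_arc_dist ip s y `^ p + (pi - great_arc_dist ip s y) `^ p -
  (pi / 2) `^ p *+ 2.

Let half_piD : pi / 2 *+ 2 = pi :> R.
Proof. by rewrite -mulr_natr divfK. Qed.

Let half_pi_gt0 : 0 < pi / 2 :> R.
Proof. by rewrite divr_gt0 ?pi_gt0. Qed.

Lemma antipodal_excess_ge0 s y : 0 <= antipodal_excess s y.
Proof.
rewrite subr_ge0 -{2}half_piD powR_antipodal_ge// half_piD.
exact: great_arc_dist_itv.
Qed.

Lemma antipodal_excess_gt0 s y :
  ip (sphere_val s) (sphere_val y) != 0 -> 0 < antipodal_excess s y.
Proof.
move=> sy0; rewrite subr_gt0 -{2}half_piD powR_antipodal_gt// ?half_piD.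
  exact: great_arc_dist_itv.
(* Taking cosines, distance [pi / 2] would force orthogonality. *)
apply: contra_neq sy0 => /(congr1 cos).
by rewrite acosK ?cos_pihalf// in_itv/= ip_sphere_itv.
Qed.

Lemma antipodal_excess_eq0 s y :
  ip (sphere_val s) (sphere_val y) = 0 -> antipodal_excess s y = 0.
Proof.
move=> sy0; rewrite /antipodal_excess /great_arc_dist sy0 acos0.
by rewrite -{2}half_piD mulr2n addrK -mulr2n subrr.
Qed.

Lemma antipodal_excess_le s y : antipodal_excess s y <= pi `^ p *+ 2.
Proof.
have /andP[d0 dpi] := great_arc_dist_itv s y.
have pi0 : (0 : R) <= pi := pi_ge0 R.
have h1 : great_arc_dist ip s y `^ p <= pi `^ p by rewrite ge0_ler_powR ?nnegrE.
have h2 : (pi - great_arc_dist ip s y) `^ p <= pi `^ p.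
  by rewrite ge0_ler_powR ?nnegrE ?subr_ge0// lerBlDr lerDl.
have h3 : 0 <= (pi / 2) `^ p :> R by exact: powR_ge0.
rewrite /antipodal_excess; lra.
Qed.

Variable x : nat -> sphere_type infH.

Let excess s k : \bar R := (dyadic_weight R k * antipodal_excess s (x k))%:E.

Let excess_ge0 s k : (0 <= excess s k)%E.
Proof. by rewrite lee_fin mulr_ge0 ?dyadic_weight_ge0 ?antipodal_excess_ge0. Qed.

(** The minimum of each pair is split off; as the weights sum to 1/2, these minima add up to a
    constant independent of [s]. *)
Lemma Lp_functional_antipodal s :
  Lp_functional ip p (antipodal_measure x) s =
  (((pi / 2) `^ p)%:E + \sum_(0 <= k <oo) excess s k)%E.
Proof.
rewrite /Lp_functional.
rewrite (@ge0_integral_antipodal _ _ _ x (fun y => great_arc_dist ip s y `^ p)).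
- transitivity (\sum_(0 <= k <oo)
      (((pi / 2) `^ p *+ 2)%:E * (dyadic_weight R k)%:E + excess s k))%E.
    apply: eq_eseriesr => k _; rewrite -EFinM -EFinD great_arc_dist_antipode.
    by congr EFin; rewrite /antipodal_excess; ring.
  rewrite nneseriesD => [||k _ _]; last exact: excess_ge0; last first.
    by move=> k _ _; rewrite mule_ge0 ?lee_fin ?dyadic_weight_ge0 ?mulrn_wge0 ?powR_ge0.
  congr (_ + _)%E.
  rewrite nneseriesZl => [|k _]; last by rewrite lee_fin dyadic_weight_ge0.
  by rewrite dyadic_weight_tail -EFinM; congr EFin; field.
- exact: (measurableT_comp (measurable_powR p) (measurable_great_arc_dist s)).
- by move=> y; exact: powR_ge0.
Qed.

(** Orthogonality kills the first [n] terms; the uniform bound on the excess makes the rest a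
    geometric tail. *)
Lemma excess_series_le s n :
  (forall k, (k < n)%N -> ip (sphere_val s) (sphere_val (x k)) = 0) ->
  (\sum_(0 <= k <oo) excess s k <= (pi `^ p / 2 ^+ n)%:E)%E.
Proof.
move=> sx; rewrite (nneseries_split 0 n) => [|k _]; last exact: excess_ge0.
rewrite add0n big_nat big1 ?add0e => [|k /andP[_ kn]]; last first.
  by rewrite /excess antipodal_excess_eq0 ?mulr0// sx.
apply: (@le_trans _ _
    (\sum_(n <= k <oo) ((pi `^ p *+ 2)%:E * (dyadic_weight R k)%:E))%E).
  apply: lee_nneseries => [k _ _|k _]; first exact: excess_ge0.
  by rewrite -EFinM lee_fin mulrC ler_wpM2r ?dyadic_weight_ge0 ?antipodal_excess_le.
rewrite nneseriesZl => [|k _]; last by rewrite lee_fin dyadic_weight_ge0.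
rewrite dyadic_weight_tail -EFinM lee_fin exprS -mulr_natr.
by rewrite invfM !mulrA mulr1 mulfK.
Qed.

(** Comparing a centre [s] with unit vectors orthogonal to the first [n] points would bound one
    fixed positive term of its excess series by a quantity tending to 0. *)
Lemma Lp_centres_antipodal_eq0 :
  (forall s, exists k, ip (sphere_val s) (sphere_val (x k)) != 0) ->
  Lp_centres ip p (antipodal_measure x) = set0.
Proof.
move=> xtotal; rewrite -subset0 => s /= sE; have [k sxk] := xtotal s.
have ek0 : 0 < dyadic_weight R k * antipodal_excess s (x k).
  by rewrite mulr_gt0 ?dyadic_weight_gt0 ?antipodal_excess_gt0.
have le_ek n : dyadic_weight R k * antipodal_excess s (x k) <= pi `^ p / 2 ^+ n.
  have [v v1 vx] := exists_unit_orthogonal norm_ip (fun i => sphere_val (x i)) n infH.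
  have sv : (Lp_functional ip p (antipodal_measure x) s <=
      Lp_functional ip p (antipodal_measure x) (to_sphere infH v1))%E.
    by rewrite sE; apply: ereal_inf_lbound; exists (to_sphere infH v1).
  move: sv; rewrite !Lp_functional_antipodal leeD2lE// => sv.
  rewrite -lee_fin; apply: le_trans (le_trans sv (@excess_series_le (to_sphere infH v1) n vx)).
  (* The [k]-th term is at most the whole series, since the other terms are nonnegative. *)
  rewrite (nneseriesD1 (n := k))//.
  by apply: leeDl; apply: nneseries_ge0 => i _ _; exact: excess_ge0.
have : (fun n => pi `^ p / 2 ^+ n) @ \oo --> (0 : R).
  rewrite -[X in _ --> X](mulr0 (pi `^ p)); apply: cvgMr.
  under eq_fun do rewrite -exprVn.
  by apply: cvg_expr; rewrite ger0_norm ?invr_ge0// invf_lt1 ?ltr1n.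
move/cvgr_lt => /(_ _ ek0) [n _ /(_ n (leqnn n))] /=.
by rewrite ltNge le_ek.
Qed.

End NoCentre.

Theorem proposition1 (R : realType) (H : completeNormedModType R)
    (ip : {dot H for idfun})
    (norm_ip : forall x : H, `|x| = Num.sqrt (ip x x))
    (sepH : separable_space H)
    (infH : ~ finite_dimensional H)
    (p : R) (p_gt1 : 1 < p) :
  exists nu : probability (borel_sphere infH) R, Lp_centres ip p nu = set0.
Proof.
have [x x1 xtotal] := exists_total_unit_sequence norm_ip sepH infH.
exists (antipodal_measure (fun n => to_sphere infH (x1 n))).
apply: Lp_centres_antipodal_eq0 => // s; apply: xtotal.
by rewrite -normr_gt0 norm_sphere_val.
Qed.
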